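(* Let $k \ge 1$ be an integer. If $G$ is a connected graph with diameter $d$, then \[ \gamma_k(G) \ge \frac{d+1}{2k+1}. \]
   Context: All graphs are finite, simple and undirected. For vertices $u,v$ of a graph $G$, $d_G(u,v)$ is the number of edges of a shortest $(u,v)$-path. The diameter of a connected graph is the maximum distance between two of its vertices. A set $S \subseteq V(G)$ is a $k$-dominating set of $G$ if every vertex of $G$ is at distance at most $k$ in $G$ from some vertex of $S$. The $k$-domination number $\gamma_k(G)$ is the minimum cardinality of a $k$-dominating set of $G$. *)

(* Defs.v *)
From mathcomp Require Import all_boot.
Set Implicit Arguments.
Unset Strict Implicit.
Unset Printing Implicit Defensive.

(* A graph is a symmetric irreflexive relation e on a finType T of vertices;
   symmetry and irreflexivity are hypotheses where they are used. *)
Section Graph.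
Variables (T : finType) (e : rel T).
Implicit Types (u v : T) (S : {set T}).

(* u :: p is a path from u to v; its number of edges is size p. *)
Definition graph_path u v (p : seq T) :=
  [&& path e u p, last u p == v & uniq (u :: p)].

(* A path has fewer than #|T| edges, so for connected u and v this is the least
   length of a path; dist u v = #|T| when v is not reachable from u. *)
Definition dist u v : nat :=
  find (fun n => [exists p : n.-tuple T, graph_path u v p]) (iota 0 #|T|).

(* The graph without vertices is not connected. *)
Definition connected_graph : bool :=
  (0 < #|T|) && [forall u, forall v, connect e u v].

Definition diameter : nat := \max_u \max_v dist u v.

(* The condition connect e u v excludes the default value of dist. *)
Definition k_dominating k S : bool :=
  [forall v, exists u in S, connect e u v && (dist u v <= k)].

(* The whole vertex set is k-dominating, so the minimum ranges over a nonempty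
   family (see domination_numberP). *)
Definition domination_number k : nat :=
  #|[arg min_(S < [set: T] | k_dominating k S) #|S| ]|.

Lemma dist_path u v : connect e u v ->
  exists2 p, graph_path u v p & size p = dist u v.
Proof.
move=> /connectP[p0 ep0]; have [p ep up _] := shortenP ep0 => def_v.
have gp : graph_path u v p by rewrite /graph_path ep def_v eqxx up.
have szp : size p < #|T| by rewrite cardE; apply: (uniq_leq_size up) => x _; rewrite mem_enum.
pose P n := [exists q : n.-tuple T, graph_path u v q].
rewrite -[dist u v]/(find P (iota 0 #|T|)).
have hP : has P (iota 0 #|T|).
  apply/hasP; exists (size p); first by rewrite mem_iota add0n szp.
  by apply/existsP; exists (in_tuple p).
have lt_f : find P (iota 0 #|T|) < #|T| by rewrite has_find size_iota in hP.
have := nth_find 0 hP; rewrite nth_iota // add0n.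
by case/existsP=> q gq; exists q; rewrite ?size_tuple.
Qed.

Lemma dist_min u v p : graph_path u v p -> dist u v <= size p.
Proof.
move=> gp; have /and3P[_ _ up] := gp; rewrite leqNgt; apply/negP => lt_p.
have szp : size p < #|T| by rewrite cardE; apply: (uniq_leq_size up) => x _; rewrite mem_enum.
have := before_find 0 lt_p; rewrite nth_iota // add0n => /negbT/negP[].
by apply/existsP; exists (in_tuple p).
Qed.

Lemma k_dominatingT k : k_dominating k [set: T].
Proof.
apply/forallP => v; apply/existsP; exists v; rewrite inE connect0 /=.
by apply: leq_trans (@dist_min v v [::] _) _; rewrite /graph_path /= ?eqxx.
Qed.

Lemma domination_numberP k :
  (exists2 S, k_dominating k S & #|S| = domination_number k) /\
  (forall S, k_dominating k S -> domination_number k <= #|S|).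
Proof.
by rewrite /domination_number;
   case: arg_minnP => [|S domS minS]; [exact: k_dominatingT | split=> //; exists S].
Qed.

End Graph.

(* Main.v *)
(* On a shortest path from x to y with dist x y = d, the distance from x takes
   every value 0, ..., d.  A vertex s is within k only of vertices whose
   distance from x lies in [dist x s - k, dist x s + k], an interval with at
   most 2k + 1 integers, so d + 1 <= (2k + 1) |S| for a k-dominating set S. *)
Require Import Defs.
From mathcomp Require Import all_boot all_order all_algebra.
From mathcomp Require Import zify.
Import Order.TTheory GRing.Theory Num.Theory.
Local Open Scope ring_scope.

Section Distance.
Set Implicit Arguments.
Unset Strict Implicit.
Local Open Scope nat_scope.
Variables (T : finType) (e : rel T).
Implicit Types (u v w : T).

(** Shortening a walk to a path keeps only vertices of the walk, so its length cannot grow.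
    Distances can thus be bounded by concatenated or reversed walks without checking [uniq]. *)
Lemma dist_last u p : path e u p -> dist e u (last u p) <= size p.
Proof.
move=> ep; have [q eq uq sub_qp] := shortenP ep.
have gq : graph_path e u (last u q) q by rewrite /graph_path eq uq eqxx.
apply: leq_trans (dist_min gq) _.
by apply: uniq_leq_size => //; case/andP: uq.
Qed.

Lemma dist_triangle u v w : connect e u v -> connect e v w ->
  dist e u w <= dist e u v + dist e v w.
Proof.
move=> /dist_path[p /and3P[ep /eqP pv _] <-] /dist_path[q /and3P[eq /eqP qw _] <-].
have := @dist_last u (p ++ q).
by rewrite cat_path last_cat size_cat pv qw; apply; rewrite ep.
Qed.

Lemma dist_sym_le u v : symmetric e -> connect e u v -> dist e v u <= dist e u v.
Proof.
move=> e_sym /dist_path[p /and3P[ep /eqP <- _] <-].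
have: path e (last u p) (rev (belast u p)).
  by rewrite rev_path; under eq_path do rewrite e_sym.
move/dist_last; rewrite size_rev size_belast.
by case: (p) => //= a q; rewrite rev_cons last_rcons.
Qed.

Lemma dist_sym u v : symmetric e -> connect e u v -> dist e v u = dist e u v.
Proof.
move=> e_sym uv; apply/eqP; rewrite eqn_leq !dist_sym_le //.
by rewrite sym_connect_sym.
Qed.

Lemma dist_attained u w i : connect e u w -> i <= dist e u w ->
  exists2 v, connect e u v & dist e u v = i.
Proof.
move=> uw; have [p /and3P[ep /eqP pw _] szp] := dist_path uw => le_i.
move: ep; rewrite -[p](cat_take_drop i) cat_path => /andP[ep1 ep2].
have lastE : last (last u (take i p)) (drop i p) = w.
  by rewrite -last_cat cat_take_drop.
have uv : connect e u (last u (take i p)) by apply/connectP; exists (take i p).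
have vw : connect e (last u (take i p)) w by apply/connectP; exists (drop i p).
exists (last u (take i p)) => //.
(* The two pieces bound the distances by [i] and [dist e u w - i]; the triangle inequality forces
   equality in both. *)
have := dist_last ep1; have := dist_last ep2; have := dist_triangle uv vw.
rewrite lastE size_drop size_takel ?szp //; lia.
Qed.

Lemma diameter_attained : 0 < #|T| -> exists u v, dist e u v = diameter e.
Proof.
move=> T_gt0; rewrite /diameter.
have [u ->] := bigop.eq_bigmax (fun u => \max_v dist e u v) T_gt0.
by have [v ->] := bigop.eq_bigmax (dist e u) T_gt0; exists u, v.
Qed.

End Distance.

(** The window embeds in the [2 * k + 1] integers from [a - k] on, even when [a < k] and this
    difference truncates to 0. *)
Lemma card_ord_window n a k :
  (#|[set i : 'I_n | (a <= i + k) && (i <= a + k)]| <= 2 * k + 1)%N.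
Proof.
rewrite cardE -(size_map val) -[leqRHS](size_iota (a - k)).
apply: uniq_leq_size; first by rewrite map_inj_uniq ?enum_uniq //; apply: val_inj.
move=> _ /mapP[i + ->]; rewrite mem_enum inE mem_iota /=; lia.
Qed.

Lemma diameter_k_dominating (T : finType) (e : rel T) k (S : {set T}) :
  symmetric e -> connected_graph e -> k_dominating e k S ->
  ((diameter e).+1 <= #|S| * (2 * k + 1))%N.
Proof.
move=> e_sym /andP[T_gt0 /forallP conn] /forallP domS.
have {}conn u v : connect e u v by have /forallP := conn u.
have [x [y <-]] := diameter_attained e T_gt0.
pose W s := [set i : 'I_(dist e x y).+1 |
  (dist e x s <= i + k) && (i <= dist e x s + k)]%N.
have cover_W : [set: 'I_(dist e x y).+1] \subset \bigcup_(s in S) W s.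
  (* [i] is at most [dist e x y], so some vertex [v] lies at distance [i] from [x]; a vertex [s]
     dominating [v] has [i] in its window. *)
  apply/subsetP => i _; have [v _ xv] := dist_attained (conn x y) (ltn_ord i).
  have /existsP[s /and3P[sS _ sv]] := domS v.
  apply/bigcupP; exists s => //; rewrite inE -xv.
  (* The two triangle inequalities show that the distances from [x] to [v] and to [s] differ by at
     most [k]. *)
  have := dist_triangle (conn x v) (conn v s).
  have := dist_triangle (conn x s) (conn s v).
  by rewrite (dist_sym e_sym (conn s v)); lia.
rewrite -[leqLHS]card_ord -cardsT -sum_nat_const.
apply: leq_trans (subset_leq_card cover_W) _.
(* Union bound, with the constant sum over [S] built up alongside the union. *)
elim/big_ind2: _ => [|m A n B leA leB|s _]; first by rewrite cards0.
  exact: leq_trans (leq_card_setU A B).1 (leq_add leA leB).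
exact: card_ord_window.
Qed.

Theorem theorem7 (T : finType) (e : rel T) (k d : nat)
    (e_sym : symmetric e) (e_irr : irreflexive e)
    (k_ge1 : (1 <= k)%N)
    (e_conn : connected_graph e) (diam_e : diameter e = d) :
  (d + 1)%:R / (2 * k + 1)%:R <= (domination_number e k)%:R :> rat.
Proof.
have [[S domS <-] _] := domination_numberP e k.
rewrite ler_pdivrMr ?ltr0n 1?addnC // -natrM ler_nat add1n -diam_e.
exact: diameter_k_dominating.
Qed.
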